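(* Let $S=\mathcal{S}(Y;S_\alpha;\phi_{\alpha,\beta})$ be a strong semilattice of left ample semigroups $S_\alpha$ $(\alpha\in Y)$ such that the connecting morphisms $\phi_{\alpha,\beta}$ are $(2,1)$-morphisms. Suppose that each $S_\alpha$, $\alpha\in Y$, has (LC) and that $S$ has (LC). For each $\alpha\in Y$, let $Q_\alpha$ be the inverse hull of $S_\alpha$ (with $S_\alpha$ identified with its image $S_\alpha\theta_{S_\alpha}$ in $Q_\alpha$). Then for any $\alpha,\beta\in Y$ with $\alpha\geq\beta$, $\phi_{\alpha,\beta}$ lifts to a morphism $\overline{\phi_{\alpha,\beta}}:Q_\alpha\to Q_\beta$. Further, $Q=\mathcal{S}(Y;Q_\alpha;\overline{\phi_{\alpha,\beta}})$ is a strong semilattice of inverse semigroups, such that $S$ is a straight left I-order in $Q$. Moreover, $Q$ is isomorphic to the inverse hull of $S$.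
   Context: For a semigroup $S$, $a\,\mathcal{R}^*\,b$ means that for all $x,y\in S^1$, $xa=ya\Leftrightarrow xb=yb$. A semigroup $S$ is left ample if $E(S)$ is a semilattice, every $\mathcal{R}^*$-class contains a (necessarily unique) idempotent, the one in the class of $a$ being denoted $a^+$, and $xy^+=(xy^+)^+x$ for all $x,y\in S$. A $(2,1)$-morphism between left ample semigroups is a semigroup morphism preserving $^+$. A semigroup $S$ has (LC) if for any $a,b\in S$ there is $c\in S$ with $Sa\cap Sb=Sc$. Inverse hull: for $S$ left ample and $a\in S$, let $\rho_a$ be the partial one-one map of $S$ with domain $Sa^+$, image $Sa$ and $x\rho_a=xa$ (maps written on the right, composed left to right). Then $\theta_S:a\mapsto\rho_a$ is an embedding of $S$ in the symmetric inverse semigroup $\mathcal{I}_S$, and the inverse hull $\Sigma(S)$ is the inverse subsemigroup of $\mathcal{I}_S$ generated by $S\theta_S$. (The strong semilattice $S$ in the statement is itself left ample, so it has an inverse hull.) Strong semilattice: $S=\mathcal{S}(Y;S_\alpha;\phi_{\alpha,\beta})$ means $Y$ is a semilattice, $S$ is the disjoint union of semigroups $S_\alpha$ $(\alpha\in Y)$, there are morphisms $\phi_{\alpha,\beta}:S_\alpha\to S_\beta$ for $\alpha\geq\beta$ with $\phi_{\alpha,\alpha}$ the identity and $\phi_{\alpha,\beta}\phi_{\beta,\gamma}=\phi_{\alpha,\gamma}$ for $\alpha\geq\beta\geq\gamma$, and the product of $a\in S_\alpha$, $b\in S_\beta$ is $ab=(a\phi_{\alpha,\alpha\beta})(b\phi_{\beta,\alpha\beta})$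 computed in $S_{\alpha\beta}$. That $\phi_{\alpha,\beta}$ lifts to $\overline{\phi_{\alpha,\beta}}$ means that $\overline{\phi_{\alpha,\beta}}$ restricted to $S_\alpha$ (under the identifications) is $\phi_{\alpha,\beta}$. A subsemigroup $S$ of an inverse semigroup $Q$ is a straight left I-order in $Q$ if every $q\in Q$ can be written as $q=a^{-1}b$ with $a,b\in S$ and $a\,\mathcal{R}\,b$ in $Q$ (Green's relation; $a^{-1}$ is the inverse in $Q$). *)

(* Defs.v *)
From HB Require Import structures.
From mathcomp Require Import all_boot all_order.
From mathcomp Require Import boolp classical_sets.

Set Implicit Arguments.
Unset Strict Implicit.
Unset Printing Implicit Defensive.

Import Order.TTheory.
Local Open Scope group_scope.
Local Open Scope classical_set_scope.

Section Semigroups.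
Variable S : semigroupType.
Implicit Types (a b e f : S) (x y : option S).

Definition idempotents : set S := [set e | e * e = e].

Definition idempotents_semilattice :=
  forall e f, idempotents e -> idempotents f ->
    idempotents (e * f) /\ e * f = f * e.

(* The left action of S^1 on S; [None] is the adjoined identity. An identity is
   adjoined even if S is a monoid, in which case it acts as the identity of S
   does. *)
Definition lact1 x a : S := oapp (fun s => s * a) a x.

Definition Rstar a b := forall x y, lact1 x a = lact1 y a <-> lact1 x b = lact1 y b.

(* S a, not S^1 a *)
Definition left_mul_ideal a : set S := [set s * a | s in [set: S]].

Definition LC :=
  forall a b, exists c,
    left_mul_ideal a `&` left_mul_ideal b = left_mul_ideal c.

(* a S^1 *)
Definition right_ideal a : set S := [set a] `|` [set a * s | s in [set: S]].

Definition greenR a b := right_ideal a = right_ideal b.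

Definition inverse_of a b := a * b * a = a /\ b * a * b = b.

Definition inverse_semigroup := forall a, exists! b, inverse_of a b.

Definition inverse_subsemigroup (A : set S) :=
  (forall a b, A a -> A b -> A (a * b)) /\
  (forall a b, inverse_of a b -> A a -> A b).

End Semigroups.

(* The operation [plus] is determined by the multiplication: an R*-class
   contains at most one idempotent when idempotents commute. *)
HB.mixin Record Semigroup_isLeftAmple S of Semigroup S := {
  plus : S -> S;
  left_ample_semilattice : idempotents_semilattice S;
  plus_idempotent : forall a : S, idempotents (plus a);
  plus_Rstar : forall a : S, Rstar a (plus a);
  left_ample_identity : forall x y : S, x * plus y = plus (x * plus y) * x
}.

#[short(type="leftAmpleType")]
HB.structure Definition LeftAmple := {S of Semigroup_isLeftAmple S & Semigroup S}.

(* [i : S -> Q] exhibits S as a subsemigroup of Q. *)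
Definition straight_left_I_order (S Q : semigroupType) (i : S -> Q) :=
  [/\ inverse_semigroup Q,
      {morph i : a b / a * b},
      injective i &
      forall q : Q, exists (a b : S) (a' : Q),
        [/\ inverse_of (i a) a', greenR (i a) (i b) & q = a' * i b]].

Definition isomorphic (S T : semigroupType) :=
  exists f : {multiplicative S -> T}, bijective f.

(* Partial one-one maps of X, represented by their graphs. *)
Record pinj (X : Type) := Pinj {
  graph :> X -> X -> Prop;
  pinj_fun : forall x y z, graph x y -> graph x z -> y = z;
  pinj_inj : forall x y z, graph x z -> graph y z -> x = y
}.

Lemma pinjP X (f g : pinj X) : (forall x y, f x y <-> g x y) -> f = g.
Proof.
case: f g => [f f1 f2] [g g1 g2] /= fg.
have e : f = g by apply/funext => x; apply/funext => y; apply/propext.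
by subst g; congr Pinj; apply: Prop_irrelevance.
Qed.

HB.instance Definition _ X := gen_eqMixin (pinj X).
HB.instance Definition _ X := gen_choiceMixin (pinj X).

Section SymmetricInverse.
Variable X : Type.
Implicit Types f g h : pinj X.

(* Maps are composed from left to right. *)
Let comp f g (x z : X) := exists2 y, f x y & g y z.

Fact comp_fun f g x y z : comp f g x y -> comp f g x z -> y = z.
Proof.
move=> [u fxu guy] [v fxv]; rewrite -(pinj_fun fxu fxv).
exact: pinj_fun guy.
Qed.

Fact comp_inj f g x y z : comp f g x z -> comp f g y z -> x = y.
Proof.
move=> [u fxu guz] [v fyv gvz]; move: fyv; rewrite -(pinj_inj guz gvz).
exact: pinj_inj fxu.
Qed.

Definition pcomp f g := Pinj (@comp_fun f g) (@comp_inj f g).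

Fact pcompA : associative pcomp.
Proof.
move=> f g h; apply: pinjP => x y; split.
  by move=> [u fxu [v guv hvy]]; exists v => //; exists u.
by move=> [v [u fxu guv] hvy]; exists u => //; exists v.
Qed.

(* The symmetric inverse semigroup on X. *)
HB.instance Definition _ := isSemigroup.Build (pinj X) pcompA.

End SymmetricInverse.

Section InverseHull.
Variable S : leftAmpleType.
Implicit Types a x y z : S.

Let rho_graph a x y := left_mul_ideal (plus a) x /\ y = x * a.

Fact rho_fun a x y z : rho_graph a x y -> rho_graph a x z -> y = z.
Proof. by move=> [_ ->] [_ ->]. Qed.

Fact rho_inj a x y z : rho_graph a x z -> rho_graph a y z -> x = y.
Proof.
move=> [[s _ <-] ->] [[t _ <-]] /(plus_Rstar a (Some _) (Some _)) /=.
by rewrite -!mulgA plus_idempotent.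
Qed.

(* x |-> x a from S a^+ onto S a *)
Definition rho a : pinj S := Pinj (@rho_fun a) (@rho_inj a).

Definition hull_set : set (pinj S) :=
  smallest (@inverse_subsemigroup (pinj S)) (range rho).

Definition hull_pred : {pred pinj S} := fun f => `[< hull_set f >].

Fact hullP f : reflect (hull_set f) (f \in hull_pred).
Proof. exact: asboolP. Qed.

Fact hull_mulg_closed : mulg_closed hull_pred.
Proof.
move=> f g /hullP hf /hullP hg; apply/hullP => A hA.
case: (hA) => [[mulA _] _]; exact: mulA (hf A hA) (hg A hA).
Qed.

(* The inverse hull of S. *)
Record hull : Type := Hull { hull_val :> pinj S; _ : hull_val \in hull_pred }.
HB.instance Definition _ := [isSub for hull_val].
HB.instance Definition _ := [Choice of hull by <:].
HB.instance Definition _ :=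
  SubChoice_isSubSemigroup.Build (pinj S) hull_pred hull hull_mulg_closed.

Fact rho_hull a : rho a \in hull_pred.
Proof. by apply/hullP; apply: sub_gen_smallest; exists a. Qed.

Definition theta a : hull := Hull (rho_hull a).

End InverseHull.

(* A semilattice is a meet-semilattice whose product is the meet, so that
   b <= a iff a `&` b = b. *)
Record connecting d (Y : meetSemilatticeType d) (S : Y -> semigroupType) :=
  Connecting {
    conn : forall a b : Y, (b <= a)%O -> {multiplicative S a -> S b};
    conn_id : forall a (h : (a <= a)%O) x, conn h x = x;
    conn_comp : forall a b c (hab : (b <= a)%O) (hbc : (c <= b)%O)
                       (hac : (c <= a)%O) x,
      conn hbc (conn hab x) = conn hac x
  }.

(* The disjoint union of the [S a]. The argument [phi] determines the product
   put on it below. *)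
Definition strong d (Y : meetSemilatticeType d) (S : Y -> semigroupType)
    (phi : connecting S) : Type :=
  {a : Y & S a}.

Section StrongSemilattice.
Context d (Y : meetSemilatticeType d) (S : Y -> semigroupType).
Variable phi : connecting S.

HB.instance Definition _ := Choice.copy (strong phi) {a : Y & S a}.

Implicit Types u v w : strong phi.

Definition strong_mul u v : strong phi :=
  Tagged S (conn phi (leIl (tag u) (tag v)) (tagged u) *
            conn phi (leIr (tag v) (tag u)) (tagged v)).

Fact conn_irr (a b : Y) (h h' : (b <= a)%O) x : conn phi h x = conn phi h' x.
Proof. by rewrite (bool_irrelevance h h'). Qed.

(* Equality in the disjoint union, tested in all the components below. *)
Fact strong_eqP u v :
  u = v <-> tag u = tag v /\
    forall c (hu : (c <= tag u)%O) (hv : (c <= tag v)%O),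
      conn phi hu (tagged u) = conn phi hv (tagged v).
Proof.
split=> [->|]; first by split=> // c hu hv; apply: conn_irr.
case: u v => [a x] [b y] /= [e]; subst b => /(_ a (lexx a) (lexx a)).
by rewrite !conn_id => ->.
Qed.

Fact strong_mul_conn u v c (h : (c <= tag (strong_mul u v))%O)
    (hu : (c <= tag u)%O) (hv : (c <= tag v)%O) :
  conn phi h (tagged (strong_mul u v)) =
    conn phi hu (tagged u) * conn phi hv (tagged v).
Proof.
by rewrite /= gmulfM; congr (_ * _); apply: conn_comp.
Qed.

Fact strong_mulA : associative strong_mul.
Proof.
move=> u v w; apply/strong_eqP; split=> [|c h h']; first by rewrite /= meetA.
have /= := h; rewrite !lexI => /and3P[hu hv hw].
have huv : (c <= tag (strong_mul u v))%O by rewrite /= lexI hu.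
have hvw : (c <= tag (strong_mul v w))%O by rewrite /= lexI hv.
by rewrite (strong_mul_conn h hu hvw) (strong_mul_conn h' huv hw)
  (strong_mul_conn _ hu hv) (strong_mul_conn _ hv hw) mulgA.
Qed.

HB.instance Definition _ := isSemigroup.Build (strong phi) strong_mulA.

End StrongSemilattice.

Section StrongLeftAmple.
Context d (Y : meetSemilatticeType d) (S : Y -> leftAmpleType).
Variables (phi : connecting S).
Hypothesis phi_plus :
  forall a b (h : (b <= a)%O) x, conn phi h (plus x) = plus (conn phi h x).

Implicit Types u v w : strong phi.

Definition strong_plus u : strong phi := Tagged S (plus (tagged u)).

Fact strong_idem u : idempotents u <-> idempotents (tagged u).
Proof.
split=> [/strong_eqP[_ E]|E].
  have h : (tag u <= tag (u * u))%O by rewrite /= meetxx.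
  move: (E (tag u) h (lexx _)).
  by rewrite (strong_mul_conn _ (lexx _) (lexx _)) !conn_id.
apply/strong_eqP; split=> [|c h hu]; first by rewrite /= meetxx.
by rewrite (strong_mul_conn h hu hu) -gmulfM E.
Qed.

Fact strong_semilattice : idempotents_semilattice (strong phi).
Proof.
have idemM a b (h : (b <= a)%O) e : idempotents e -> idempotents (conn phi h e).
  by rewrite /idempotents /= -gmulfM => ->.
move=> u v /strong_idem hu /strong_idem hv; split.
  by apply/strong_idem; apply: (left_ample_semilattice _ _ _ _).1; apply: idemM.
apply/strong_eqP; split=> [|c h h']; first by rewrite /= meetC.
have /= := h; rewrite lexI => /andP[cu cv].
rewrite (strong_mul_conn h cu cv) (strong_mul_conn h' cv cu).
by apply: (left_ample_semilattice _ _ _ _).2; apply: idemM.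
Qed.

Fact strong_plus_idem u : idempotents (strong_plus u).
Proof. by apply/strong_idem; apply: plus_idempotent. Qed.

Fact strong_plus_Rstar u : Rstar u (strong_plus u).
Proof.
have tagE (x : option (strong phi)) :
    tag (lact1 x (strong_plus u)) = tag (lact1 x u) by case: x.
have act (x : option (strong phi)) c (hu : (c <= tag u)%O) :
    (c <= tag (lact1 x u))%O -> exists x' : option (S c),
    (forall h, conn phi h (tagged (lact1 x u)) = lact1 x' (conn phi hu (tagged u)))
    /\ (forall h, conn phi h (tagged (lact1 x (strong_plus u)))
                  = lact1 x' (plus (conn phi hu (tagged u)))).
  case: x => [x|] /= hc.
    have hx : (c <= tag x)%O by move: hc; rewrite /= lexI => /andP[].
    exists (Some (conn phi hx (tagged x))); split=> h /=.
      exact: strong_mul_conn.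
    rewrite -phi_plus; exact: (@strong_mul_conn _ _ _ phi x (strong_plus u)).
  exists None; split=> h /=; first exact: conn_irr.
  by rewrite -phi_plus; apply: conn_irr.
have le_u x : (tag (lact1 x u) <= tag u)%O by case: x => //= x; apply: leIr.
move=> x y; split=> /strong_eqP[e E]; apply/strong_eqP; split.
- by rewrite !tagE.
- move=> c hx hy.
  have hx1 : (c <= tag (lact1 x u))%O by rewrite -tagE.
  have hy1 : (c <= tag (lact1 y u))%O by rewrite -tagE.
  have hu := le_trans hx1 (le_u x).
  have [x' [x1 x2]] := act x c hu hx1; have [y' [y1 y2]] := act y c hu hy1.
  rewrite x2 y2; apply: (plus_Rstar _ x' y').1.
  by rewrite -(x1 hx1) -(y1 hy1); apply: E.
- by rewrite -!tagE.
- move=> c hx hy; have hu := le_trans hx (le_u x).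
  have [x' [x1 x2]] := act x c hu hx; have [y' [y1 y2]] := act y c hu hy.
  have hx1 : (c <= tag (lact1 x (strong_plus u)))%O by rewrite tagE.
  have hy1 : (c <= tag (lact1 y (strong_plus u)))%O by rewrite tagE.
  rewrite x1 y1; apply: (plus_Rstar _ x' y').2.
  by rewrite -(x2 hx1) -(y2 hy1); apply: E.
Qed.

Fact strong_ample u v : u * strong_plus v = strong_plus (u * strong_plus v) * u.
Proof.
apply/strong_eqP; split=> [|c h h']; first by rewrite /= meetAC meetxx.
have /= := h; rewrite lexI => /andP[cu cv].
have cw : (c <= tag (strong_plus (u * strong_plus v)))%O := h.
have E k : conn phi k (tagged (u * strong_plus v)) =
    conn phi cu (tagged u) * plus (conn phi cv (tagged v)).
  by rewrite -phi_plus; apply: (strong_mul_conn (v := strong_plus v) k cu cv).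
rewrite E (strong_mul_conn h' cw cu) left_ample_identity; congr (_ * _).
by rewrite -(E h) -phi_plus; apply: conn_irr.
Qed.

Definition strong_left_ample : leftAmpleType :=
  HB.pack_for leftAmpleType (strong phi)
    (Semigroup_isLeftAmple.Build (strong phi) strong_semilattice
      strong_plus_idem strong_plus_Rstar strong_ample).

End StrongLeftAmple.

(* Main.v *)
From HB Require Import structures.
Require Import Defs.
From mathcomp Require Import all_boot all_order.
From mathcomp Require Import boolp classical_sets.

Set Implicit Arguments.
Unset Strict Implicit.
Unset Printing Implicit Defensive.

Import Order.TTheory.
Local Open Scope group_scope.
Local Open Scope classical_set_scope.

(** The inverse hull of a left ample semigroup S with (LC) consists of fractions
a^{-1} b with a R* b. Here rho_a^{-1} rho_b has the graph
{(s a, s b) | s in S}, the left S-act generated by the pair (a, b)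
([fraction]), a description in terms of R* alone. Fractions contain every
rho_a and are closed under inverses. They are closed under products by (LC): if
Sb and Sc meet in Sw and w = u b = v c, then
(a^{-1} b) (c^{-1} d) = (u a)^{-1} (v d) ([fraction_mul], [hull_fraction]).

A morphism psi : S -> T preserving plus preserves R*, so a^{-1} b |->
psi(a)^{-1} psi(b) makes sense. It is well defined because two pairs generating
the same left act are left multiples of each other, which psi preserves. It is
multiplicative as soon as psi carries a generator of the intersection of Sa and
Sb to a generator of that of T psi(a) and T psi(b)
([preserves_LC], [hull_lift]).

In the strong semilattice S, take x in S_a and c below a. The multiples of x that
lie in S_c are exactly the multiples in S_c of the image of x
([left_mul_ideal_conn]). By (LC) for S_a, a generator of the intersection of Sx
and Sy with x and y in S_a lies in S_a itself ([strong_LC_component]). Reading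
the intersection in a lower component, or in the whole of S, shows that both the
connecting morphisms and the inclusions of S_a in S satisfy [preserves_LC].

The lifts of the connecting morphisms are the connecting morphisms of Q. The
lifts of the inclusions together map Q to the inverse hull of S ([strong_hull]).
This map is onto because R*-related elements of S lie in one component. It is
injective because the pairs of a fraction of S_a that lie in S_a give the
fraction back ([strong_hull_inc]). It is multiplicative because moving p in Q_a
down to Q_c restricts its image to the arguments in components below c
([strong_hull_conn]), and composing two partial maps from Q_a and Q_b only
involves arguments in components below both a and b. *)

(** * Inverses in the symmetric inverse semigroup *)

Section Converse.
Variable X : Type.
Implicit Types f g : pinj X.

Definition pconv f : pinj X :=
  Pinj (fun x y z hy hz => pinj_inj (p := f) hy hz)
       (fun x y z hx hy => pinj_fun (p := f) hx hy).

Lemma pconv_inverse f : inverse_of f (pconv f).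
Proof.
split; apply: pinjP => x y; split.
- by move=> [z [t fxt fzt] fzy]; rewrite (pinj_inj fxt fzt).
- by move=> fxy; exists x => //; exists y.
- by move=> [z [t ftx ftz] fyz]; rewrite /= (pinj_fun (p := f) ftx ftz).
- by move=> fyx; exists x => //; exists y.
Qed.

Lemma inverse_of_graph f g x y : inverse_of f g -> f x y -> g y x.
Proof.
move=> [e _] fxy; have [z [t fxt gtz] fzy] : (f * g * f)%g x y by rewrite e.
by rewrite (pinj_fun fxy fxt) (pinj_inj fxy fzy).
Qed.

Lemma inverse_of_pconv f g : inverse_of f g -> g = pconv f.
Proof.
move=> fg; apply: pinjP => x y; split.
  by apply: (@inverse_of_graph g f); case: fg.
exact: (@inverse_of_graph f g).
Qed.

End Converse.

Lemma greenR_mul (S : semigroupType) (a b s t : S) :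
  b = a * s -> a = b * t -> greenR a b.
Proof.
have sub (x y r : S) : y = x * r -> right_ideal y `<=` right_ideal x.
  move=> -> z [->|[s' _ <-]]; right; first by exists r.
  by exists (r * s'); rewrite ?mulgA.
by move=> /sub ba /sub ab; apply/seteqP.
Qed.

(** * The relation R* in a left ample semigroup *)

Section LeftAmpleTheory.
Variable S : leftAmpleType.
Implicit Types a b c x : S.

Lemma plus_mul a : plus a * a = a.
Proof. exact/(plus_Rstar a (Some _) None)/plus_idempotent. Qed.

Lemma plusC a b : plus a * plus b = plus b * plus a.
Proof.
have Eb := plus_idempotent b.
by have [] := left_ample_semilattice _ _ (plus_idempotent a) Eb.
Qed.

Lemma mem_left_mul_ideal a : left_mul_ideal a a.
Proof. by exists (plus a) => //; apply: plus_mul. Qed.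

Lemma Rstar_sym a b : Rstar a b -> Rstar b a.
Proof. by move=> ab x y; rewrite ab. Qed.

Lemma Rstar_trans b a c : Rstar a b -> Rstar b c -> Rstar a c.
Proof. by move=> ab bc x y; rewrite ab bc. Qed.

Lemma Rstar_mull x a b : Rstar a b -> Rstar (x * a) (x * b).
Proof.
have act y c : lact1 y (x * c) = lact1 (Some (lact1 y x)) c.
  by case: y => //= y; rewrite mulgA.
by move=> ab y z; rewrite !act.
Qed.

(** If e and f are commuting idempotents with e R* f, then e f = f and f e = e,
so e = f. *)
Lemma Rstar_plus a b : Rstar a b <-> plus a = plus b.
Proof.
split=> [ab|e]; last first.
  apply: (Rstar_trans (plus_Rstar a)); rewrite e.
  exact/Rstar_sym/plus_Rstar.
have pR : Rstar (plus a) (plus b).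
  apply: Rstar_trans (plus_Rstar b); apply: Rstar_trans ab.
  exact/Rstar_sym/plus_Rstar.
have /= E1 := (pR (Some (plus a)) None).1 (plus_idempotent a).
have /= E2 := (pR (Some (plus b)) None).2 (plus_idempotent b).
by rewrite -E2 -plusC E1.
Qed.

End LeftAmpleTheory.

(** * Fractions *)

Section Fractions.
Variable S : leftAmpleType.
Implicit Types (a b c d u v w x y s : S) (p q : pinj S).

(** The condition says that p is a^{-1} b for a R* b. It is a relation, rather
than an operation on a and b, so that no proof of R* occurs in the partial
maps. *)
Definition fraction p a b :=
  Rstar a b /\ forall x y, p x y <-> exists s, x = s * a /\ y = s * b.

Lemma fraction_uniq p q a b : fraction p a b -> fraction q a b -> p = q.
Proof. by move=> [_ pP] [_ qP]; apply: pinjP => x y; rewrite pP qP. Qed.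

(** The generating pair itself lies in the graph, as a^+ fixes both a and b.
Hence two representations of one fraction are left multiples of each other. *)
Lemma fraction_graph p a b : fraction p a b -> p a b.
Proof.
move=> [ab pP]; apply/pP; exists (plus a); split; first by rewrite plus_mul.
exact/esym/(ab (Some _) None)/plus_mul.
Qed.

Lemma fraction_rho a : fraction (rho a) (plus a) a.
Proof.
split=> [|x y]; first exact/Rstar_sym/plus_Rstar.
split=> [[[s _ <-] ->]|[s [-> ->]]].
  by exists s; rewrite -mulgA plus_mul.
by split; [exists s | rewrite -mulgA plus_mul].
Qed.

Lemma fraction_pconv p a b : fraction p a b -> fraction (pconv p) b a.
Proof.
move=> [ab pP]; split=> [|x y]; first exact: Rstar_sym.
by rewrite /= pP; split=> -[s [-> ->]]; exists s.
Qed.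

(** A pair of the first graph and a pair of the second can be composed when
s b = t c, which is then a multiple r w = r u b = r v c; by R*, s a = r u a and
t d = r v d. *)
Lemma fraction_mul p q a b c d u v w :
    fraction p a b -> fraction q c d ->
    left_mul_ideal b `&` left_mul_ideal c = left_mul_ideal w ->
    u * b = w -> v * c = w ->
  fraction (p * q) (u * a) (v * d).
Proof.
move=> [ab pP] [cd qP] bcw ub vc; split.
  apply: (Rstar_trans (Rstar_mull u ab)); rewrite ub -vc; exact: Rstar_mull.
move=> x z; split.
  move=> [y /pP[s [-> ->]] /qP[t [st ->]]].
  have : left_mul_ideal w (s * b).
    by rewrite -bcw; split; [exists s | rewrite st; exists t].
  move=> [r _ rw]; exists r; split; rewrite mulgA.
    by apply: (ab (Some _) (Some _)).2; rewrite /= -mulgA ub.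
  by apply: (cd (Some _) (Some _)).1; rewrite /= -mulgA vc -st.
move=> [r [-> ->]]; exists (r * w).
  by apply/pP; exists (r * u); rewrite -!mulgA ub.
by apply/qP; exists (r * v); rewrite -!mulgA vc.
Qed.

(** The common middle term makes both left ideals in [fraction_mul] equal to Sb,
with b = b^+ b. *)
Lemma fraction_chain p q a b c :
  fraction p a b -> fraction q b c -> fraction (p * q) a c.
Proof.
move=> pab qbc.
have [pbb ab] : plus b * b = b /\ plus b = plus a.
  by rewrite plus_mul; split=> //; apply/esym/Rstar_plus; case: pab.
have bc : plus b = plus c by apply/Rstar_plus; case: qbc.
have := fraction_mul pab qbc (setIid _) pbb pbb.
by rewrite {1}ab bc !plus_mul.
Qed.

End Fractions.

(** * The inverse hull *)

Section HullInverse.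
Variable S : leftAmpleType.
Implicit Types (p q : hull S) (a b : S).

Lemma hull_set_pconv (f : pinj S) : hull_set f -> hull_set (pconv f).
Proof.
move=> hf A hA; case: (hA) => [[_ invA] _].
exact: invA (pconv_inverse f) (hf A hA).
Qed.

Lemma hull_valP q : hull_set q.
Proof. by case: q => f /= /hullP. Qed.

Lemma hull_val_inj : injective (@hull_val S).
Proof. exact: val_inj. Qed.

Lemma hull_inverse_of p q : inverse_of p q <-> inverse_of (hull_val p) q.
Proof.
split=> [[pqp qpq]|[pqp qpq]].
  by split; [rewrite -{3}pqp | rewrite -{3}qpq].
by split; apply: hull_val_inj.
Qed.

Lemma hull_inverse_semigroup : inverse_semigroup (hull S).
Proof.
move=> q; have /hullP hq := hull_set_pconv (hull_valP q).
exists (Hull hq); split; first exact/hull_inverse_of/pconv_inverse.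
move=> r /hull_inverse_of /inverse_of_pconv e; exact/hull_val_inj/esym.
Qed.

(** Equality of rho_a and rho_b forces S a^+ = S b^+, hence a^+ = b^+, and a is
the image of a^+ under rho_a. *)
Lemma theta_inj : injective (@theta S).
Proof.
move=> a b /(congr1 (@hull_val S)) /= e.
have Ea := fraction_rho a; have Eb := fraction_rho b.
have := fraction_graph Ea; rewrite e => /(Eb.2 _ _).1 [s [E1 E2]].
have := fraction_graph Eb; rewrite -e => /(Ea.2 _ _).1 [t [F1 F2]].
have ab : plus a = plus b.
  have ab : plus a * plus b = plus a by rewrite E1 -mulgA plus_idempotent.
  by rewrite -ab plusC F1 -mulgA plus_idempotent.
by apply: (pinj_fun (p := rho a) (x := plus a)); [exact: fraction_graph |
  rewrite e ab; exact: fraction_graph].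
Qed.

(** The left ample identity x y^+ = (x y^+)^+ x says that a b^+ generates
the intersection of Sa and S b^+, so the product of
rho_a = (a^+)^{-1} a and rho_b = (b^+)^{-1} b can be computed as
a product of fractions. *)
Lemma theta_mul : {morph @theta S : a b / a * b}.
Proof.
move=> a b; apply: hull_val_inj; apply: (fraction_uniq (fraction_rho (a * b))).
have abI : left_mul_ideal a `&` left_mul_ideal (plus b) =
    left_mul_ideal (a * plus b).
  apply/seteqP; split=> [_ [[s _ <-] [t _ tb]]|_ [s _ <-]].
    by exists s => //; rewrite mulgA -tb -mulgA plus_idempotent.
  split; last by exists (s * a) => //; rewrite mulgA.
  by exists (s * plus (a * plus b)) => //; rewrite -mulgA -left_ample_identity.
have := fraction_mul (fraction_rho a) (fraction_rho b) abI
  (esym (left_ample_identity a b)) (erefl _).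
have -> // : plus (a * plus b) * plus a = plus (a * b).
have /Rstar_plus <- := Rstar_mull a (plus_Rstar b).
rewrite plusC; apply/(plus_Rstar (a * b) (Some _) None).
by rewrite /= mulgA plus_mul.
Qed.

Lemma fraction_hull a b : Rstar a b -> exists q, fraction q a b.
Proof.
move=> ab.
have mulh (f g : pinj S) : hull_set f -> hull_set g -> hull_set (f * g).
  by move=> /hullP hf /hullP hg; apply/hullP/hull_mulg_closed.
have /hullP h : hull_set (pconv (rho a) * rho b).
  by apply: mulh; [apply: hull_set_pconv|]; apply/hullP/rho_hull.
exists (Hull h); apply: (fraction_chain (b := plus a)).
  exact/fraction_pconv/fraction_rho.
by rewrite (iffLR (Rstar_plus a b) ab); apply: fraction_rho.
Qed.

(** The fractions form an inverse subsemigroup containing all the rho_a, and the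
hull is the least such subsemigroup. *)
Lemma hull_fraction (LC_S : LC S) q : exists a b, fraction q a b.
Proof.
suff sub : @hull_set S `<=` [set f | exists a b, fraction f a b].
  exact: sub (hull_valP q).
apply: smallest_sub; last first.
  by move=> _ [a _ <-]; exists (plus a), a; apply: fraction_rho.
split=> [f g [a [b fab]] [c [d gcd]]|f g fg [a [b fab]]]; last first.
  by rewrite (inverse_of_pconv fg); exists b, a; apply: fraction_pconv.
have [w bcw] := LC_S b c.
have [[u _ ub] [v _ vc]] : (left_mul_ideal b `&` left_mul_ideal c) w.
  by rewrite bcw; apply: mem_left_mul_ideal.
by exists (u * a), (v * d); apply: fraction_mul fab gcd bcw ub vc.
Qed.

End HullInverse.

(** * Lifting morphisms to inverse hulls *)

(** As a generator of an intersection is not unique, the condition asks for one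
generator whose image is again a generator; in particular it contains (LC) for
S. *)
Definition preserves_LC (S T : semigroupType) (psi : S -> T) :=
  forall a b, exists w,
    left_mul_ideal a `&` left_mul_ideal b = left_mul_ideal w /\
    left_mul_ideal (psi a) `&` left_mul_ideal (psi b) = left_mul_ideal (psi w).

Section HullLift.
Variables (S T : leftAmpleType) (psi : S -> T).
Hypothesis psiM : {morph psi : x y / x * y}.
Hypothesis psi_plus : {morph psi : x / plus x}.
Hypothesis psi_LC : preserves_LC psi.
Implicit Types (a b c d : S) (p q : hull S).

Lemma preserves_LC_dom : LC S.
Proof. by move=> a b; have [w [e _]] := psi_LC a b; exists w. Qed.

Lemma Rstar_morph a b : Rstar a b -> Rstar (psi a) (psi b).
Proof. by move=> /Rstar_plus e; apply/Rstar_plus; rewrite -!psi_plus e. Qed.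

(** Since (a, b) lies in q, it is a left multiple t (c, d), so (psi a, psi b) is
the left multiple by psi t of (psi c, psi d). *)
Lemma fraction_morph_sub q a b c d (r r' : pinj T) x y :
    fraction q a b -> fraction q c d ->
    fraction r (psi a) (psi b) -> fraction r' (psi c) (psi d) ->
  r x y -> r' x y.
Proof.
move=> qab qcd [_ rP] [_ r'P] /rP[s [-> ->]].
have [t [-> ->]] := (qcd.2 a b).1 (fraction_graph qab).
by apply/r'P; exists (s * psi t); rewrite !psiM !mulgA.
Qed.

Lemma hull_lift_exists q : exists r : hull T,
  forall a b, fraction q a b -> fraction r (psi a) (psi b).
Proof.
have [a [b qab]] := hull_fraction preserves_LC_dom q.
have [r rab] := fraction_hull (Rstar_morph qab.1); exists r => c d qcd.
have [r' r'cd] := fraction_hull (Rstar_morph qcd.1).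
suff -> : (r : pinj T) = r' by [].
apply: pinjP => x y; split; first exact: fraction_morph_sub qab qcd rab r'cd.
exact: fraction_morph_sub qcd qab r'cd rab.
Qed.

Definition hull_lift q : hull T := projT1 (cid (hull_lift_exists q)).

Lemma hull_liftP q a b :
  fraction q a b -> fraction (hull_lift q) (psi a) (psi b).
Proof. exact: (projT2 (cid (hull_lift_exists q))). Qed.

Lemma hull_lift_theta a : hull_lift (theta a) = theta (psi a).
Proof.
apply/hull_val_inj/(fraction_uniq (a := plus (psi a)) (b := psi a)).
  by rewrite -psi_plus; apply/hull_liftP/fraction_rho.
exact: fraction_rho.
Qed.

Lemma hull_lift_mul : {morph hull_lift : p q / p * q}.
Proof.
move=> p q; have [a [b pab]] := hull_fraction preserves_LC_dom p.
have [c [d qcd]] := hull_fraction preserves_LC_dom q.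
have [w [bcw bcw']] := psi_LC b c.
have [[u _ ub] [v _ vc]] : (left_mul_ideal b `&` left_mul_ideal c) w.
  by rewrite bcw; apply: mem_left_mul_ideal.
apply/hull_val_inj/(fraction_uniq (a := psi (u * a)) (b := psi (v * d))).
  exact/hull_liftP/(fraction_mul pab qcd bcw ub vc).
rewrite !psiM; apply: (fraction_mul (hull_liftP pab) (hull_liftP qcd) bcw').
  by rewrite -psiM ub.
by rewrite -psiM vc.
Qed.

HB.instance Definition _ :=
  isMultiplicative.Build (hull S) (hull T) hull_lift hull_lift_mul.

End HullLift.

(** * Strong semilattices of semigroups *)

Section StrongTheory.
Context d (Y : meetSemilatticeType d) (S : Y -> semigroupType).
Variable phi : connecting S.
Implicit Types (a b c : Y) (u v : strong phi).

Definition inc a (x : S a) : strong phi := Tagged S x.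

Lemma inc_inj a : injective (@inc a).
Proof.
move=> x y /strong_eqP[_ /(_ a (lexx a) (lexx a))].
by rewrite !conn_id.
Qed.

Lemma inc_mul_conn a c (h : (c <= a)%O) (s : S c) (x : S a) :
  inc s * inc x = inc (s * conn phi h x).
Proof.
apply/strong_eqP; split=> [|e h1 h2 /=]; first exact: meet_l.
rewrite (strong_mul_conn h1 (h2 : (e <= tag (inc s))%O) (le_trans h2 h)) gmulfM.
by congr (_ * _); apply/esym/conn_comp.
Qed.

Lemma inc_mul a : {morph @inc a : x y / x * y}.
Proof. by move=> x y; rewrite (inc_mul_conn (lexx a)) conn_id. Qed.

(** Left multiplication by u on S_a only depends on one element s of the
component in which the products lie. The same s serves all x, so this applies to
the two coordinates of a pair simultaneously. *)
Lemma mul_inc_factor u a c (h : (c <= a)%O) : (tag u `&` a)%O = c ->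
  exists s : S c, forall x : S a, u * inc x = inc (s * conn phi h x).
Proof.
move=> e; subst c; exists (conn phi (leIl _ _) (tagged u)) => x.
by congr inc; congr (_ * _); apply: conn_irr.
Qed.

Lemma left_mul_ideal_tag u v : left_mul_ideal u v -> (tag v <= tag u)%O.
Proof. by move=> [s _ <-]; apply: leIr. Qed.

Lemma inc_inverse_of a (x y : S a) :
  inverse_of (inc x) (inc y) <-> inverse_of x y.
Proof.
rewrite /inverse_of -!inc_mul; split=> -[E1 E2]; last by rewrite E1 E2.
by split; apply: inc_inj.
Qed.

(** Mutually inverse elements lie in the same component. *)
Lemma strong_inverse_semigroup :
  (forall a, inverse_semigroup (S a)) -> inverse_semigroup (strong phi).
Proof.
move=> invS [a x]; have [y [xy y_uniq]] := invS a x.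
exists (inc y); split=> [|[b z] uz]; first exact/inc_inverse_of.
have [/(congr1 tag) /= le1 /(congr1 tag) /= le2] := uz.
have e : b = a.
  apply: le_anti; apply/andP; split; [rewrite -{1}le2 | rewrite -{1}le1].
    exact: le_trans (leIl _ _) (leIr _ _).
  exact: le_trans (leIl _ _) (leIr _ _).
subst b; by rewrite (y_uniq z) //; apply/inc_inverse_of.
Qed.

End StrongTheory.

(** * Strong semilattices of left ample semigroups *)

Section StrongLC.
Context d (Y : meetSemilatticeType d) (S : Y -> leftAmpleType).
Variable phi : connecting S.
Hypothesis phi_plus :
  forall a b (h : (b <= a)%O) x, conn phi h (plus x) = plus (conn phi h x).
Hypothesis LC_S_ : forall a, LC (S a).
Hypothesis LC_S : LC (strong phi).
Implicit Types (a b c : Y) (u v : strong phi).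

Local Notation sS := (strong_left_ample phi_plus).
Local Notation incS a := (@inc _ _ _ phi a : S a -> sS).

Lemma left_mul_ideal_conn a c (h : (c <= a)%O) (x : S a) (y : S c) :
  left_mul_ideal (conn phi h x) y <-> left_mul_ideal (inc phi x) (inc phi y).
Proof.
split=> [[s _ <-]|[u _ uxy]].
  by exists (inc phi s) => //; apply: inc_mul_conn.
have [s sE] := mul_inc_factor h (congr1 tag uxy).
by exists s => //; apply: (@inc_inj _ _ _ phi); rewrite -sE.
Qed.

Lemma left_mul_ideal_inc a (x y : S a) :
  left_mul_ideal x y <-> left_mul_ideal (inc phi x) (inc phi y).
Proof. by rewrite -(left_mul_ideal_conn (lexx a)) conn_id. Qed.

(** A generator w of the intersection in S lies in a component c below a since
it is a multiple of x. (LC) for S_a makes the intersection meet S_a, and an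
element of S_a that is a multiple of w forces a to be below c. *)
Lemma strong_LC_component a (x y : S a) : exists w : S a,
  left_mul_ideal (inc phi x) `&` left_mul_ideal (inc phi y) =
  left_mul_ideal (inc phi w).
Proof.
have [[c w] xyw] := LC_S (inc phi x) (inc phi y).
have [w' xyw'] := LC_S_ x y.
have ca : (c <= a)%O.
  have [/left_mul_ideal_tag //] :
      (left_mul_ideal (inc phi x) `&` left_mul_ideal (inc phi y)) (inc phi w).
  by rewrite xyw; apply: (@mem_left_mul_ideal sS).
have ac : (a <= c)%O.
  have [xw' yw'] : (left_mul_ideal x `&` left_mul_ideal y) w'.
    by rewrite xyw'; apply: mem_left_mul_ideal.
  suff /left_mul_ideal_tag : left_mul_ideal (inc phi w) (inc phi w') by [].
  by rewrite -xyw; split; apply/left_mul_ideal_inc.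
have e : c = a by apply: le_anti; rewrite ca.
by subst c; exists w.
Qed.

Lemma preserves_LC_conn a b (h : (b <= a)%O) : preserves_LC (conn phi h).
Proof.
move=> x y; have [w xyw] := strong_LC_component x y; exists w.
split; apply/seteqP; split=> z.
- move=> [/left_mul_ideal_inc xz /left_mul_ideal_inc yz].
  by apply/left_mul_ideal_inc; rewrite -xyw.
- move=> /left_mul_ideal_inc; rewrite -xyw => -[xz yz].
  by split; apply/left_mul_ideal_inc.
- move=> [/left_mul_ideal_conn xz /left_mul_ideal_conn yz].
  by apply/left_mul_ideal_conn; rewrite -xyw.
- move=> /left_mul_ideal_conn; rewrite -xyw => -[xz yz].
  by split; apply/left_mul_ideal_conn.
Qed.

Lemma preserves_LC_inc a : preserves_LC (incS a).
Proof.
move=> x y; have [w xyw] := strong_LC_component x y; exists w; split=> //.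
apply/seteqP; split=> z.
  move=> [/left_mul_ideal_inc xz /left_mul_ideal_inc yz].
  by apply/left_mul_ideal_inc; rewrite -xyw.
move=> /left_mul_ideal_inc; rewrite -xyw => -[xz yz].
by split; apply/left_mul_ideal_inc.
Qed.

(** * The strong semilattice of the inverse hulls *)

Definition hull_conn a b (h : (b <= a)%O) :
    {multiplicative hull (S a) -> hull (S b)} :=
  hull_lift (@gmulfM _ _ (conn phi h)) (phi_plus h) (preserves_LC_conn h).

Lemma hull_connP a b (h : (b <= a)%O) (q : hull (S a)) x y :
  fraction q x y -> fraction (hull_conn h q) (conn phi h x) (conn phi h y).
Proof. exact: hull_liftP. Qed.

Lemma hull_conn_id a (h : (a <= a)%O) q : hull_conn h q = q.
Proof.
have [x [y qxy]] := hull_fraction (@LC_S_ a) q.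
apply/hull_val_inj/(fraction_uniq (a := x) (b := y)) => //.
by rewrite -(conn_id phi h x) -(conn_id phi h y); apply: hull_connP.
Qed.

Lemma hull_conn_comp a b c (hab : (b <= a)%O) (hbc : (c <= b)%O)
    (hac : (c <= a)%O) q :
  hull_conn hbc (hull_conn hab q) = hull_conn hac q.
Proof.
have [x [y qxy]] := hull_fraction (@LC_S_ a) q.
apply: hull_val_inj; apply: (fraction_uniq _ (hull_connP hac qxy)).
rewrite -!(conn_comp phi hab hbc hac); exact/hull_connP/hull_connP.
Qed.

Definition hull_connecting : connecting (fun a => hull (S a)) :=
  Connecting hull_conn_id hull_conn_comp.

Lemma hull_connecting_theta a b (h : (b <= a)%O) (x : S a) :
  conn hull_connecting h (theta x) = theta (conn phi h x).
Proof. exact: hull_lift_theta. Qed.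

Local Notation hS := (strong hull_connecting).

Lemma strong_straight_left_I_order :
  straight_left_I_order
    (fun u : strong phi =>
       Tagged (fun a => hull (S a)) (theta (tagged u)) : hS).
Proof.
split.
- by apply: strong_inverse_semigroup => a; apply: hull_inverse_semigroup.
- move=> u v; congr Tagged; rewrite theta_mul.
  by rewrite !hull_connecting_theta.
- move=> [a x] [b y] /strong_eqP[/= e]; subst b.
  by move=> /(_ a (lexx a) (lexx a)) /=; rewrite !hull_conn_id => /theta_inj ->.
move=> [a q]; have [x [y qxy]] := hull_fraction (@LC_S_ a) q.
have xy : plus x = plus y by apply/Rstar_plus; case: qxy.
have [r rx] := fraction_hull (plus_Rstar x).
have [q' q'yx] := fraction_hull (Rstar_sym qxy.1).
have tx : fraction (theta x) (plus x) x := fraction_rho x.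
have ty : fraction (theta y) (plus x) y by rewrite xy; apply: fraction_rho.
(* Here r = x^{-1} x^+ is the inverse of theta x, and q' = y^{-1} x that of q.
As x^+ = y^+, one has r * theta y = q, theta x * q = theta y and
theta y * q' = theta x. *)
exists (inc phi x), (inc phi y), (inc hull_connecting r); split.
- apply/inc_inverse_of/hull_inverse_of.
  rewrite (fraction_uniq rx (fraction_pconv tx)).
  exact: pconv_inverse.
- apply: (@greenR_mul _ _ _ (inc hull_connecting q)
                            (inc hull_connecting q')).
    rewrite -inc_mul; congr Tagged; apply: hull_val_inj.
    exact: (fraction_uniq ty (fraction_chain tx qxy)).
  rewrite -inc_mul; congr Tagged; apply: hull_val_inj.
  exact: (fraction_uniq tx (fraction_chain ty q'yx)).
- rewrite -inc_mul; congr Tagged; apply: hull_val_inj.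
  exact: (fraction_uniq qxy (fraction_chain rx ty)).
Qed.

(** * The inverse hull of the strong semilattice *)

Lemma incS_mul a : {morph incS a : x y / x * y}.
Proof. exact: inc_mul. Qed.

Definition strong_hull (p : hS) : hull sS :=
  hull_lift (@incS_mul (tag p)) (fun _ => erefl) (@preserves_LC_inc (tag p))
    (tagged p).

Lemma strong_hullP a (q : hull (S a)) x y : fraction q x y ->
  fraction (strong_hull (inc hull_connecting q)) (incS a x) (incS a y).
Proof. exact: hull_liftP. Qed.

Lemma strong_hull_tag p u v :
  strong_hull p u v -> (tag u <= tag p)%O /\ tag u = tag v.
Proof.
case: p => a q; have [x [y qxy]] := hull_fraction (@LC_S_ a) q.
move=> /(strong_hullP qxy).2 [s [-> ->]]; split=> //; exact: leIr.
Qed.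

(** If the product of s with x, or with the image x' of x in S_c, lies in a
component e below c, then s can be replaced by its image t in S_e, and
t x = t x'. *)
Lemma strong_hull_conn a c (h : (c <= a)%O) q u v :
  strong_hull (inc hull_connecting (hull_conn h q)) u v <->
  strong_hull (inc hull_connecting q) u v /\ (tag u <= c)%O.
Proof.
have [x [y qxy]] := hull_fraction (@LC_S_ a) q.
rewrite (strong_hullP qxy).2 (strong_hullP (hull_connP h qxy)).2.
split=> [[s [-> ->]]|[[s [-> ->]] /= sac]].
  split; last exact: leIr.
  have hc := leIr c (tag s).
  have [t tE] := @mul_inc_factor _ _ _ phi s _ _ hc erefl.
  exists (inc phi t); rewrite !tE !(inc_mul_conn phi (le_trans hc h)).
  by rewrite !(conn_comp phi h hc (le_trans hc h)).
have hsa := leIr a (tag s).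
have [t tE] := @mul_inc_factor _ _ _ phi s _ _ hsa erefl.
exists (inc phi t); rewrite !tE !(inc_mul_conn phi sac).
by rewrite !(conn_comp phi h sac hsa).
Qed.

Lemma strong_hull_mul : {morph strong_hull : p q / p * q}.
Proof.
move=> [a p] [b q]; rewrite {1}/strong_hull hull_lift_mul.
apply/hull_val_inj/pinjP => u w; split.
  by move=> [v /strong_hull_conn[puv _] /strong_hull_conn[qvw _]]; exists v.
move=> [v puv qvw]; have [ua uv] := strong_hull_tag puv.
have [vb _] := strong_hull_tag qvw; have vab : (tag v <= a `&` b)%O.
  by rewrite lexI vb -uv ua.
by exists v; apply/strong_hull_conn; rewrite ?uv.
Qed.

HB.instance Definition _ :=
  isMultiplicative.Build hS (hull sS) strong_hull strong_hull_mul.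

(** Multiples of elements of S_a that lie in S_a can be written with a factor in
S_a. *)
Lemma strong_hull_inc a (q : hull (S a)) x y :
  strong_hull (inc hull_connecting q) (inc phi x) (inc phi y) <-> q x y.
Proof.
have [z [t qzt]] := hull_fraction (@LC_S_ a) q.
rewrite (strong_hullP qzt).2 qzt.2; split=> [[u [xuz yut]]|[s [-> ->]]].
  have ua := congr1 tag (esym xuz).
  have [s sE] := @mul_inc_factor _ _ _ phi u _ _ (lexx a) ua.
  exists s; move: xuz yut; rewrite !sE !conn_id.
  by move=> /inc_inj -> /inc_inj ->.
by exists (inc phi s); rewrite !inc_mul.
Qed.

(** If p and q have the same image, a generating pair of p, which lies in the
component of p, belongs to the image of q, so the component of p is below that
of q. By symmetry they are equal, and [strong_hull_inc] recovers both graphs. *)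
Lemma strong_hull_inj : injective strong_hull.
Proof.
have tag_le p q : strong_hull p = strong_hull q -> (tag p <= tag q)%O.
  case: p => a p /= pq; have [x [y pxy]] := hull_fraction (@LC_S_ a) p.
  have := fraction_graph (strong_hullP pxy).
  by rewrite [strong_hull _]pq => /strong_hull_tag[].
move=> p q pq; have e : tag p = tag q by apply: le_anti; rewrite !tag_le.
case: p q e pq => a p [b q] /= e; subst b => pq; congr Tagged.
apply/hull_val_inj/pinjP => x y; rewrite -!strong_hull_inc.
by rewrite [strong_hull _]pq.
Qed.

Lemma strong_hull_surj (r : hull sS) : exists p, strong_hull p = r.
Proof.
have [[a x] [[b y] rxy]] := hull_fraction (LC_S : LC sS) r.
have /Rstar_plus xy := rxy.1; have /= e := congr1 tag xy; subst b.
have {}xy : Rstar x y by apply/Rstar_plus; apply: (@inc_inj _ _ _ phi).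
have [q qxy] := fraction_hull xy; exists (inc hull_connecting q).
exact/hull_val_inj/(fraction_uniq (strong_hullP qxy)).
Qed.

Lemma strong_hull_bij : bijective strong_hull.
Proof.
have [g gK] := choice strong_hull_surj.
by exists g => // p; apply: strong_hull_inj; rewrite gK.
Qed.

End StrongLC.

Theorem theorem4p3 (d : Order.disp_t) (Y : meetSemilatticeType d)
    (S : Y -> leftAmpleType) (phi : connecting S)
    (phi_plus : forall (a b : Y) (h : (b <= a)%O) (x : S a),
        conn phi h (plus x) = plus (conn phi h x))
    (LC_S_ : forall a : Y, LC (S a))
    (LC_S : LC (strong phi)) :
  exists phibar : connecting (fun a => hull (S a)),
    (forall (a b : Y) (h : (b <= a)%O) (x : S a),
        conn phibar h (theta x) = theta (conn phi h x)) /\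
    (forall a : Y, inverse_semigroup (hull (S a))) /\
    straight_left_I_order
      (fun u : strong phi =>
         Tagged (fun a => hull (S a)) (theta (tagged u)) : strong phibar) /\
    isomorphic (strong phibar) (hull (strong_left_ample phi_plus)).
Proof.
exists (hull_connecting phi_plus LC_S_ LC_S); split.
  exact: hull_connecting_theta.
split; first by move=> a; apply: hull_inverse_semigroup.
split; first exact: strong_straight_left_I_order.
by exists (@strong_hull _ _ _ _ phi_plus LC_S_ LC_S); apply: strong_hull_bij.
Qed.
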